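(* Let $b=.\overline{0b_2b_3\dots b_m}$ and $c=.\overline{1c_2c_3\dots c_n}$ be periodic itineraries, and let the two address curves $x_b(t)$, $x_c(t)$ intersect in the point $(s,z)$ inside the overlap region, i.e. $s\in(\frac12,1)$, $x_b(s)=x_c(s)=z\in[1-s,s]$. Then: (i) Infinitely many periodic address curves meet in $(s,z)$, i.e. there are infinitely many different periodic 01-sequences $d$ with $x_d(s)=z$. (ii) The growth rate of the orbit of $z$ (for the parameter $s$) is at least as large as the positive solution $x$ of $x^{-m}+x^{-n}=1$. (iii) If the growth rate of the orbit of $z$ exceeds $2s$, then the Bernoulli convolution $\nu_s$ does not have a bounded density. A possible density function of $\nu_s$ must be unbounded on each interval, and discontinuous at every point of $[0,1]$.
   Context: A 01-sequence $b_1b_2\dots$ is identified with the binary number $b=.b_1b_2\dots=\sum_k b_k2^{-k}$; an overline denotes periodic repetition of a word. It is called an itinerary if the closure of its orbit under the doubling map $x\mapsto 2x \bmod 1$ (acting as the shift) does not contain $\frac12$. The address curve of a 01-sequence $b$ is $x_b(t)=\frac{1-t}{t}\sum_{k=1}^\infty b_kt^k$. For $t\in(\frac12,1)$ and $\beta=1/t$ let $g_0:[0,t]\to[0,1]$, $g_0(x)=\beta x$, and $g_1:[1-t,1]\to[0,1]$, $g_1(x)=\beta x+1-\beta$. The Bernoulli convolution $\nu_t$ is the unique Borel probability measure on $[0,1]$ with $\nu_t(A)=\frac12\nu_t(g_0(A))+\frac12\nu_t(g_1(A))$ for all Borel sets $A\subset[0,1]$, where $g_i(A)$ is the image of the intersection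 of $A$ with the domain of $g_i$. The overlap interval for $t$ is $[1-t,t]$. Let $\gamma^q(x)$ be the number of words $w_1\dots w_q\in\{0,1\}^q$ for which $g_{w_q}\cdots g_{w_1}(x)$ is defined (the number of $q$-th generation successors of $x$, counted with multiplicity). The growth rate (of the orbit) of $x$ is $\lim_{q\to\infty}\sqrt[q]{\gamma^q(x)}$; if the limit does not exist, it is read as $\liminf_{q\to\infty}\sqrt[q]{\gamma^q(x)}$. *)

(* Defs.v *)
From mathcomp Require Export all_boot all_order all_algebra.
From mathcomp Require Export all_classical all_reals all_analysis.
Export numFieldNormedType.Exports.
Export Order.TTheory GRing.Theory Num.Theory.

Set Implicit Arguments.
Unset Strict Implicit.
Unset Printing Implicit Defensive.

Local Open Scope classical_set_scope.
Local Open Scope ring_scope.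

(* A 01-sequence b_1 b_2 ... is a function b : nat -> bool with b k standing
   for b_(k+1); this index shift accounts for the exponents k.+1 below. *)

Definition overline (w : seq bool) : nat -> bool :=
  fun k => nth false w (k %% size w)%N.

Definition periodic (d : nat -> bool) : Prop :=
  exists2 w : seq bool, w <> [::] & d = overline w.

Section RealPart.
Variable R : realType.

Definition binary_value (b : nat -> bool) : R :=
  limn (series (fun k => (b k)%:R * 2 ^- k.+1 : R)).

Definition doubling (x : R) : R := 2 * x - (Num.floor (2 * x))%:~R.

Definition itinerary (b : nat -> bool) : Prop :=
  ~ closure (range (fun k => iter k doubling (binary_value b))) 2^-1.

Definition address (b : nat -> bool) (t : R) : R :=
  (1 - t) / t * limn (series (fun k => (b k)%:R * t ^+ k.+1 : R)).

Definition gfun (t : R) (i : bool) (x : R) : R :=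
  if i then t^-1 * x + 1 - t^-1 else t^-1 * x.

Definition gdom (t : R) (i : bool) : set R :=
  if i then `[1 - t, 1]%classic else `[0, t]%classic.

(* g_i as a partial map: None outside its domain. *)
Definition gpart (t : R) (i : bool) (x : R) : option R :=
  if `[< gdom t i x >] then Some (gfun t i x) else None.

(* g_(w_q) ( ... g_(w_1) x ) for w = [:: w_1; ...; w_q], when defined. *)
Definition gword (t : R) (w : seq bool) (x : R) : option R :=
  foldl (fun y i => obind (gpart t i) y) (Some x) w.

Definition num_successors (t x : R) (q : nat) : nat :=
  #|[pred w : q.-tuple bool | isSome (gword t w x)]|.

Definition growth_rate (t x : R) : R :=
  let r := fun q : nat => (num_successors t x q)%:R `^ q%:R^-1 in
  if `[< cvgn r >] then limn r else limn_inf r.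

(* Measures on [0, 1] are represented as measures on R concentrated on [0, 1].
   The Bernoulli convolution is characterised by this property. *)
Definition is_bernoulli_convolution (t : R)
    (nu : probability (measurableTypeR R) R) : Prop :=
  nu `[0, 1]%classic = 1%E /\
  forall A : set (measurableTypeR R), measurable A -> A `<=` `[0, 1]%classic ->
    nu A = (2^-1%:E * nu (gfun t false @` (A `&` gdom t false))
          + 2^-1%:E * nu (gfun t true @` (A `&` gdom t true)))%E.

(* Only the values of f on [0, 1] matter. Nonnegativity of f almost everywhere
   on [0, 1] is a consequence, so it is not required. *)
Definition is_density (nu : probability (measurableTypeR R) R)
    (f : measurableTypeR R -> R) : Prop :=
  (@lebesgue_measure R).-integrable `[0, 1]%classic (EFin \o f) /\
  forall A : set (measurableTypeR R), measurable A -> A `<=` `[0, 1]%classic ->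
    nu A = (\int[@lebesgue_measure R]_(x in A) (f x)%:E)%E.

End RealPart.

(* Main.v *)
(** The point z is fixed by the words B = 0b_2...b_m and C = 1c_2...c_n, hence
    by every concatenation of them, and a fixed point of a word has the periodic
    repetition of that word as an address. Words that start with B or with C
    give a_q >= a_(q-m) + a_(q-n) for a_q = gamma^q(z), hence the growth rate
    bound.

    Each of the gamma^q(x) admissible words maps [x - s^q, x + s^q] onto [0, 1],
    so by self-similarity the nu_s-measure of this interval, of length 2 s^q, is
    at least 2^-q gamma^q(x). If gamma^q(x) outgrows (2s)^q, a density must be
    unbounded near x. The points x that some word maps to z are dense and
    inherit the growth rate of z. *)

Require Import Defs.
From mathcomp Require Import lra ring.

Set Implicit Arguments.
Unset Strict Implicit.
Unset Printing Implicit Defensive.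

Local Open Scope classical_set_scope.
Local Open Scope ring_scope.

(** * Words in the partial maps [g_0], [g_1] and their successor counts *)

Section PartialMaps.
Variables (R : realType) (s : R).
Hypothesis hs : 2^-1 < s < 1.

Let s_gt0 : 0 < s. Proof. by case/andP: hs; lra. Qed.
Let s_neq0 : s != 0. Proof. exact: lt0r_neq0. Qed.

(** The domain of [g_i] is exactly the image of [0, 1] under the inverse contraction y -> (1 - s) i
    + s y. Later arguments work with this contraction instead of the domains. *)
Lemma gpart_Some (i : bool) (x y : R) :
  gpart s i x = Some y <-> 0 <= y <= 1 /\ x = (1 - s) * i%:R + s * y.
Proof.
have eqg : y = gfun s i x <-> x = (1 - s) * i%:R + s * y.
  rewrite /gfun; case: i; split=> ->; rewrite /= ?mulr1n ?mulr0n;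
    by field; exact: s_neq0.
have dom : gdom s i ((1 - s) * i%:R + s * y) <-> 0 <= y <= 1.
  rewrite -(pmulr_rge0 y s_gt0) -(ger_pMr y s_gt0).
  rewrite /gdom; case: i {eqg} => /=; rewrite in_itv /=;
    rewrite /= ?mulr1n ?mulr0n;
    (split=> /andP[h1 h2]; apply/andP; split); lra.
rewrite /gpart; case: asboolP => hd; split.
- by case=> hy; have e := iffLR eqg (esym hy); split => //; apply/dom; rewrite -e.
- by case=> _ /eqg ->.
- by [].
- by case=> /dom h e; case: hd; rewrite e.
Qed.

(** Since s > 1/2, the domains [0, s] and [1 - s, 1] cover [0, 1]. *)
Lemma gpart_defined (x : R) : 0 <= x <= 1 -> exists i y, gpart s i x = Some y.
Proof.
move=> /andP[x0 x1]; case/andP: hs => hs1 hs2.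
have [xs|sx] := leP x s.
- exists false, (x / s); apply/gpart_Some.
  rewrite mulr0 add0r [s * _]mulrC divfK //; split=> //.
  by rewrite divr_ge0 ?(ltW s_gt0) //= ler_pdivrMr ?mul1r.
- exists true, ((x - (1 - s)) / s); apply/gpart_Some.
  rewrite mulr1 [s * _]mulrC divfK // subrKC; split => //.
  rewrite ler_pdivrMr // mul1r divr_ge0 ?(ltW s_gt0) //=; lra.
Qed.

Let foldl_None (w : seq bool) :
  foldl (fun y i => obind (gpart s i) y) None w = None.
Proof. by elim: w. Qed.

Lemma gword_cat (w1 w2 : seq bool) (x y : R) :
  gword s w1 x = Some y -> gword s (w1 ++ w2) x = gword s w2 y.
Proof. by rewrite /gword foldl_cat => ->. Qed.

Lemma gword_cons (i : bool) (w : seq bool) (x y : R) :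
  gpart s i x = Some y -> gword s (i :: w) x = gword s w y.
Proof. by rewrite /gword /= => ->. Qed.

Lemma gword_cons_inv (i : bool) (w : seq bool) (x y : R) :
  gword s (i :: w) x = Some y ->
  exists2 x', gpart s i x = Some x' & gword s w x' = Some y.
Proof.
rewrite /gword /=; case: gpart => [x'|] /=; first by exists x'.
by rewrite foldl_None.
Qed.

(** Every letter acts affinely with slope 1/s, whichever letter it is. *)
Lemma gword_dist (w : seq bool) (x y x' y' : R) :
  gword s w x = Some y -> gword s w x' = Some y' ->
  x - x' = s ^+ size w * (y - y').
Proof.
elim: w x x' => [|i w IH] x x'; first by case=> -> [->]; rewrite expr0 mul1r.
move=> /gword_cons_inv[x1 /gpart_Some[_ ->] /IH h].
move=> /gword_cons_inv[x1' /gpart_Some[_ ->] /h h'].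
by rewrite exprS -mulrA -h'; ring.
Qed.

Lemma num_successors0 (x : R) : num_successors s x 0 = 1%N.
Proof.
rewrite /num_successors (eq_card (B := {: 0.-tuple bool})) ?card_tuple // => w.
by rewrite !inE tuple0.
Qed.

Lemma num_successorsS (x : R) (q : nat) :
  num_successors s x q.+1 =
  (\sum_(i : bool) oapp (fun y => num_successors s y q) 0 (gpart s i x))%N.
Proof.
rewrite /num_successors -sum1_card.
rewrite (reindex (fun p : bool * q.-tuple bool => [tuple of p.1 :: p.2])) /=;
  last first.
  exists (fun t : q.+1.-tuple bool => (thead t, [tuple of behead t])) => /=.
    by move=> [i t] _; congr pair; exact: val_inj.
  by move=> t _; rewrite [RHS]tuple_eta.
rewrite (eq_bigl (fun p : bool * q.-tuple bool =>
   isSome (gword s (p.1 :: p.2) x))) //.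
rewrite -(pair_big_dep xpredT
   (fun i (w : q.-tuple bool) => isSome (gword s (i :: w) x)) (fun _ _ => 1%N)) /=.
apply: eq_bigr => i _; case e : (gpart s i x) => [y|] /=.
  rewrite -sum1_card; apply: eq_bigl => w.
  by rewrite inE (gword_cons _ e).
rewrite big_pred0 // => w; rewrite /gword /= e.
by rewrite foldl_None.
Qed.

(** Prefixing [w] turns the admissible words of [y] injectively into admissible words of [x]. *)
Lemma num_successors_gword (w : seq bool) (x y : R) (q : nat) :
  gword s w x = Some y ->
  (num_successors s y q <= num_successors s x (size w + q))%N.
Proof.
elim: w x => [|i w IH] x; first by case=> ->.
move=> /gword_cons_inv[x' hx /IH h]; rewrite addSn num_successorsS.
by rewrite (bigD1 i) //= hx (leq_trans h) ?leq_addr.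
Qed.

Lemma num_successors_gt0 (x : R) (q : nat) :
  0 <= x <= 1 -> (0 < num_successors s x q)%N.
Proof.
elim: q x => [|q IH] x x01; first by rewrite num_successors0.
have [i [y hy]] := gpart_defined x01.
rewrite num_successorsS (bigD1 i) //= hy ltn_addr // IH //.
by case/gpart_Some : hy.
Qed.

Lemma num_successors_le (x : R) (q : nat) : (num_successors s x q <= 2 ^ q)%N.
Proof. by rewrite (leq_trans (max_card _)) // card_tuple card_bool. Qed.

(** Follow [p] admissible letters from [x], then pull [z] back along the same word: the p
    contractions shrink a distance of at most 1 to at most s^p. *)
Lemma gword_dense (x z : R) (p : nat) : 0 <= x <= 1 -> 0 <= z <= 1 ->
  exists (w : p.-tuple bool) (y : R), gword s w y = Some z /\
    0 <= y <= 1 /\ `|y - x| <= s ^+ p.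
Proof.
elim: p x => [|p IH] x x01 z01.
  exists [tuple], z; split=> //; split => //.
  by rewrite expr0 ler_norml; case/andP: x01; case/andP: z01; lra.
have [i [x' /gpart_Some[x'01 ->]]] := gpart_defined x01.
have [w [y [yz [y01 yx]]]] := IH _ x'01 z01.
have gy : gpart s i ((1 - s) * i%:R + s * y) = Some y by apply/gpart_Some.
exists [tuple of i :: w], ((1 - s) * i%:R + s * y); split; last split.
- by rewrite (gword_cons _ gy).
- case/andP: y01; case/andP: hs; case: i {gy} => /=; nra.
- rewrite [X in `|X|](_ : _ = s * (y - x')); last by ring.
  by rewrite normrM (gtr0_norm s_gt0) exprS ler_pM2l.
Qed.

End PartialMaps.

(** * Address curves and the periodic addresses of a common fixed point *)

Section Addresses.
Variables (R : realType) (s : R).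
Hypothesis hs : 2^-1 < s < 1.

Let s_gt0 : 0 < s. Proof. by case/andP: hs; lra. Qed.
Let s_lt1 : s < 1. Proof. by case/andP: hs. Qed.
Let s_neq0 : s != 0. Proof. exact: lt0r_neq0. Qed.

Let term (d : nat -> bool) : R^nat := fun k => (d k)%:R * s ^+ k.+1.

Let term_ge0 d k : 0 <= term d k.
Proof. by rewrite mulr_ge0 // exprn_ge0 // ltW. Qed.

Let term_le d k : term d k <= geometric s s k.
Proof.
rewrite /= /term exprS; case: (d k); rewrite ?mul1r // mul0r.
by rewrite mulr_ge0 ?exprn_ge0 ?ltW.
Qed.

Let cvg_geo : series (geometric s s) @ \oo --> s / (1 - s).
Proof. by apply: cvg_geometric_series; rewrite gtr0_norm. Qed.

Let cvg_term d : cvgn (series (term d)).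
Proof.
apply: series_le_cvg (term_ge0 d) _ (term_le d) _; last by apply: cvgP cvg_geo.
by move=> k; exact: le_trans (term_ge0 d k) (term_le d k).
Qed.

(** The factor (1 - s)/s normalises the geometric sum s/(1 - s) of the all-ones sequence to 1. *)
Lemma address_itv (d : nat -> bool) : 0 <= address d s <= 1.
Proof.
have h0 : 0 <= limn (series (term d)).
  by apply: limr_ge => //; near=> k; rewrite seriesEnat; exact: sumr_ge0.
have h1 : limn (series (term d)) <= s / (1 - s).
  rewrite -(cvg_lim (@Rhausdorff R) cvg_geo); apply: lim_series_le => //.
  by apply: cvgP cvg_geo.
have s1 : 0 < 1 - s by rewrite subr_gt0.
rewrite /address mulr_ge0 ?divr_ge0 ?(ltW s1) ?(ltW s_gt0) //=.
rewrite -(ler_pM2l (divr_gt0 s1 s_gt0)) in h1.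
apply: le_trans h1 _; rewrite [leLHS](_ : _ = 1) //.
by field; rewrite s_neq0 subr_eq0 gt_eqF.
Unshelve. all: by end_near.
Qed.

(** This is the inverse branch of [gpart_Some]: the first letter of [d], applied as a map, shifts
    the address by one place. *)
Lemma addressS (d : nat -> bool) :
  address d s = (1 - s) * (d 0%N)%:R + s * address (fun k => d k.+1) s.
Proof.
have eqS : (fun k => series (term d) k.+1) =
    (fun k => s * (d 0%N)%:R + s * series (term (fun k => d k.+1)) k).
  apply/funext => k; rewrite !seriesEnat /= big_nat_recl //.
  rewrite {1}/term expr1 [X in X + _]mulrC.
  congr (_ + _); rewrite big_distrr /=; apply: eq_bigr => i _.
  by rewrite /term [RHS]mulrCA -exprS.
have : limn (series (term d)) =
    s * (d 0%N)%:R + s * limn (series (term (fun k => d k.+1))).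
  apply: cvg_lim => //; rewrite -cvg_shiftS /= eqS.
  by apply: cvgD; [exact: cvg_cst|apply: cvgMl_tmp; exact: cvg_term].
rewrite /address -!/(term _) => ->.
by field; exact: s_neq0.
Qed.

Lemma gword_address (d : nat -> bool) (p : nat) :
  gword s (mkseq d p) (address d s) = Some (address (fun k => d (p + k)%N) s).
Proof.
elim: p d => [|p IH] d //.
rewrite /mkseq /= (iotaDl 1 0) -map_comp.
rewrite (@gword_cons _ _ _ _ _ (address (fun k => d k.+1) s)).
  exact: IH.
by apply/(gpart_Some hs); split; [exact: address_itv|exact: addressS].
Qed.

Lemma mkseq_overline (w : seq bool) : mkseq (overline w) (size w) = w.
Proof.
apply: (@eq_from_nth _ false); rewrite size_mkseq // => i iw.
by rewrite nth_mkseq // /overline modn_small.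
Qed.

(** Shifting a periodic sequence by a full period leaves it unchanged. *)
Lemma gword_overline (w : seq bool) :
  gword s w (address (overline w) s) = Some (address (overline w) s).
Proof.
rewrite -{1}(mkseq_overline w) gword_address; congr (Some (address _ s)).
by apply/funext => k; rewrite /overline modnDl.
Qed.

(* The maps g_i are injective and expanding, so a word fixes at most one point. *)
Lemma address_overline (w : seq bool) (z : R) :
  w <> [::] -> gword s w z = Some z -> address (overline w) s = z.
Proof.
move=> w0 hz; have /eqP := gword_dist hs (gword_overline w) hz.
rewrite -subr_eq0 -{1}[_ - z]mul1r -mulrBl mulf_eq0 subr_eq0 => /orP[|]; last first.
  by rewrite subr_eq0 => /eqP.
have : s ^+ size w < 1 by rewrite exprn_ilt1 ?(ltW s_gt0) //; case: (w) w0.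
by move=> /lt_eqF sw; rewrite eq_sym sw.
Qed.

Variables (u v : seq bool) (z : R).
Hypothesis uz : gword s (false :: u) z = Some z.
Hypothesis vz : gword s (true :: v) z = Some z.

(** The concatenation (0u)^k 1v, one fixing word of [z] for each [k]. *)
Let W k := iter k (cat (false :: u)) (true :: v).

Let W_neq0 k : W k <> [::]. Proof. by case: k. Qed.

Let size_W k : (k * (size u).+1 < size (W k))%N.
Proof.
by elim: k => [//|k IH]; rewrite /W iterS -/(W k) size_cat mulSn ltn_add2l.
Qed.

Let gword_W k : gword s (W k) z = Some z.
Proof. by elim: k => [//|k IH]; rewrite /W iterS (gword_cat _ uz). Qed.

Let nth_W j k : (j <= k)%N -> nth false (W k) (j * (size u).+1) = (j == k).
Proof.
elim: k j => [|k IH] [|j] // jk.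
have -> : W k.+1 = (false :: u) ++ W k by [].
by rewrite nth_cat mulSn ltnNge leq_addr /= addKn IH.
Qed.

(* The letter at position [j * size (0u)] of (0u)^k 1v is 0 if j < k, 1 if j = k. *)
Lemma infinite_periodic_addresses :
  infinite_set [set d | periodic d /\ address d s = z].
Proof.
pose f k := overline (W k).
have f_inj : injective f.
  have main j k : (j <= k)%N -> f j = f k -> j = k.
    move=> jk /(congr1 (fun d => d (j * (size u).+1)%N)).
    rewrite /f /overline !modn_small ?size_W //; last first.
      by apply: leq_ltn_trans (size_W k); rewrite leq_mul2r jk orbT.
    by rewrite !nth_W // eqxx => /esym/eqP.
  move=> j k; case/orP: (leq_total j k) => h e; first exact: main.
  by apply/esym/main.
move=> fin; apply: infinite_nat.
have : finite_set (f @^-1` [set d | periodic d /\ address d s = z]).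
  by apply: finite_preimage fin => // x y _ _; exact: f_inj.
apply: sub_finite_set => k _ /=; split; first by exists (W k).
exact: address_overline.
Qed.

End Addresses.

(** * Bounds on the growth rate from bounds on the successor counts *)

Section GrowthRate.
Variable R : realType.

Lemma ler_powR_inv (a y : R) (q : nat) : 0 <= a -> 0 <= y -> (0 < q)%N ->
  (y <= a `^ q%:R^-1) = (y ^+ q <= a).
Proof.
move=> a0 y0 q0; have aE : (a `^ q%:R^-1) ^+ q = a.
  by rewrite -powR_mulrn ?powR_ge0 // -powRrM mulVf ?powRr1 // pnatr_eq0 -lt0n.
by rewrite -[in RHS]aE ler_pXn2r // nnegrE ?powR_ge0.
Qed.

Variables (s z : R).

Let a q : R := (num_successors s z q)%:R.
Let r q : R := a q `^ q%:R^-1.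

Let r_ge0 q : 0 <= r q. Proof. exact: powR_ge0. Qed.

Let r_le2 q : r q <= 2.
Proof.
(* At q = 0 the exponent 1/q is 0 by convention, so the root is 1. *)
case: q => [|q]; first by rewrite /r invr0 powRr0 ler1n.
have -> : 2 = (2 ^+ q.+1 : R) `^ q.+1%:R^-1.
  by rewrite -powR_mulrn // -powRrM mulfV ?powRr1.
rewrite ge0_ler_powR ?nnegrE ?invr_ge0 ?exprn_ge0 ?ler0n //.
by rewrite /a -natrX ler_nat num_successors_le.
Qed.

Let r_bounded : bounded_fun r.
Proof.
exists 2; split=> [|M M2 q _ /=]; first exact: num_real.
by rewrite ger0_norm // (le_trans (r_le2 q)) // ltW.
Qed.

(** A limit that exists equals the lower limit, so both branches of the definition agree with it;
    boundedness of [r] makes the supremum meaningful. *)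
Let growth_rateE : growth_rate s z = sup (range (infs r)).
Proof.
rewrite -limn_infE // /growth_rate -/r.
by case: asboolP => // h; rewrite cvg_limn_infE.
Qed.

Let sdrop_lb N : has_lbound (sdrop r N).
Proof. by exists 0 => _ [q _ <-]. Qed.

Lemma growth_rate_eventually_ge (y : R) : 0 <= y -> y < growth_rate s z ->
  exists N, forall q, (N <= q)%N -> y ^+ q <= (num_successors s z q)%:R.
Proof.
move=> y0; rewrite growth_rateE => /sup_gt[|_ [N _ <-] yN].
  by exists (infs r 0), 0%N.
(* The successor excludes q = 0, where no root can be taken. *)
exists N.+1 => q Nq; rewrite -/(a q) -ler_powR_inv ?ler0n ?(leq_trans _ Nq) //.
apply: (le_trans (ltW yN)); apply: ge_inf => //; exists q => //.
exact: ltnW.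
Qed.

(** A constant factor disappears under the q-th root: for any t strictly between the growth rate and
    y, C t^q < y^q eventually, which would force the growth rate up to t. *)
Lemma growth_rate_ge (y C : R) : 0 < y -> 0 < C ->
  (forall q, y ^+ q <= C * (num_successors s z q)%:R) -> y <= growth_rate s z.
Proof.
move=> y0 C0 ya; rewrite leNgt; apply/negP => gy.
have g0 : 0 <= growth_rate s z.
  rewrite growth_rateE; apply: (@le_trans _ _ (infs r 0)).
    by apply: lb_le_inf; [exists (r 0), 0%N|move=> _ [q _ <-]].
  by apply: ub_le_sup; [exact: bounded_fun_has_ubound_infs|exists 0%N].
set t := (growth_rate s z + y) / 2.
have gt : growth_rate s z < t by rewrite /t; lra.
have ty : t < y by rewrite /t; lra.
have t0 : 0 < t by exact: le_lt_trans g0 gt.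
have ty1 : `|t / y| < 1.
  by rewrite (gtr0_norm (divr_gt0 t0 y0)) ltr_pdivrMr // mul1r.
have [N _ hN] : \forall q \near \oo, (t / y) ^+ q < C^-1.
  by apply: cvgr_lt (cvg_expr ty1) _ _; rewrite invr_gt0.
suff : t <= growth_rate s z by rewrite leNgt gt.
rewrite growth_rateE; apply: (@le_trans _ _ (infs r N.+1)); last first.
  by apply: ub_le_sup; [exact: bounded_fun_has_ubound_infs|exists N.+1].
apply: lb_le_inf; first by exists (r N.+1), N.+1 => /=.
move=> _ [q /= Nq <-]; rewrite ler_powR_inv ?ler0n ?(ltW t0) ?(leq_trans _ Nq) //.
have := hN q (ltnW Nq); rewrite /= expr_div_n ltr_pdivrMr ?exprn_gt0 //.
move=> /ltW /le_trans; apply.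
by rewrite mulrC ler_pdivrMr // mulrC; exact: ya.
Qed.

(** Mirror argument: for t strictly between y and the growth rate, t^q is eventually a lower bound
    of the counts but exceeds C y^q. *)
Lemma growth_rate_le (y C : R) : 0 < y -> 0 < C ->
  (forall q, (num_successors s z q)%:R <= C * y ^+ q) -> growth_rate s z <= y.
Proof.
move=> y0 C0 ay; rewrite leNgt; apply/negP => gy.
set t := (growth_rate s z + y) / 2.
have tg : t < growth_rate s z by rewrite /t; lra.
have yt : y < t by rewrite /t; lra.
have t0 : 0 < t by exact: lt_trans y0 yt.
have [N1 ta] := growth_rate_eventually_ge (ltW t0) tg.
have yt1 : `|y / t| < 1.
  by rewrite (gtr0_norm (divr_gt0 y0 t0)) ltr_pdivrMr // mul1r.
have [N2 _ hN2] : \forall q \near \oo, (y / t) ^+ q < C^-1.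
  by apply: cvgr_lt (cvg_expr yt1) _ _; rewrite invr_gt0.
have := hN2 _ (leq_maxr N1 N2); have := ta _ (leq_maxl N1 N2).
set q := maxn N1 N2; move=> tq /=.
rewrite expr_div_n ltr_pdivrMr ?exprn_gt0 // mulrC ltr_pdivlMr // mulrC => yq.
by have := le_lt_trans (le_trans tq (ay q)) yq; rewrite ltxx.
Qed.

(* The recursion a_q >= a_(q-m) + a_(q-n) is that of the sequence x^q. *)
Lemma growth_rate_ge_root (u v : seq bool) (x : R) :
  2^-1 < s < 1 -> 0 <= z <= 1 ->
  gword s (false :: u) z = Some z -> gword s (true :: v) z = Some z ->
  0 < x -> x ^- (size u).+1 + x ^- (size v).+1 = 1 -> x <= growth_rate s z.
Proof.
move=> hs z01 uz vz x0 xE.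
(* For x < 1 both summands would be at least 1 and their sum at least 2. *)
have x1 : 1 <= x.
  rewrite leNgt; apply/negP => x1.
  have h k : 1 <= x ^- k.
    by rewrite invf_ge1 ?exprn_gt0 // exprn_ile1 // ltW.
  by have := h (size u).+1; have := h (size v).+1; lra.
(* The constant x^M absorbs the initial values q <= M, where the count is at least 1 and x^q <= x^M;
   beyond M the recursion applies. *)
pose M := maxn (size u).+1 (size v).+1.
apply: (@growth_rate_ge _ (x ^+ M)) => //; first by rewrite exprn_gt0.
elim/ltn_ind => q IH.
have [qM|Mq] := leqP q M.
  apply: (@le_trans _ _ (x ^+ M * 1)); first by rewrite mulr1 ler_weXn2l.
  by rewrite ler_pM2l ?exprn_gt0 // ler1n num_successors_gt0.
have [mq nq] : ((size u).+1 <= q /\ (size v).+1 <= q)%N.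
  by move: (ltnW Mq); rewrite geq_max => /andP[].
have -> : x ^+ q = x ^+ (q - (size u).+1) + x ^+ (q - (size v).+1).
  by rewrite !expfB_cond ?(gt_eqF x0) // -mulrDr xE mulr1.
(* The words starting with 0u and those starting with 1v differ in the first letter, so they are
   counted in different summands of [num_successorsS]. *)
have : (num_successors s z (q - (size u).+1) +
        num_successors s z (q - (size v).+1) <= num_successors s z q)%N.
  have [y0 hy0 uy0] := gword_cons_inv uz.
  have [y1 hy1 vy1] := gword_cons_inv vz.
  case: q mq nq {IH Mq} => // q mq nq.
  rewrite num_successorsS big_bool hy0 hy1 /= addnC !subSS; apply: leq_add.
    by have := num_successors_gword (q - size v) vy1; rewrite subnKC.
  by have := num_successors_gword (q - size u) uy0; rewrite subnKC.
rewrite -(ler_nat R) natrD => h.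
apply: le_trans (ler_wpM2l _ h); last by rewrite exprn_ge0 // ltW.
by rewrite mulrDr; apply: lerD; apply: IH; rewrite ltn_subrL (leq_trans _ mq).
Qed.

End GrowthRate.

(** * Mass of small balls, and densities of the Bernoulli convolution *)

Section Densities.
Variables (R : realType) (s : R) (nu : probability (measurableTypeR R) R).
Hypothesis hs : 2^-1 < s < 1.
Hypothesis hnu : is_bernoulli_convolution s nu.

Let s_gt0 : 0 < s. Proof. by case/andP: hs; lra. Qed.
Let s_ge0 : 0 <= s. Proof. exact: ltW s_gt0. Qed.

Let B (x r : R) : set R := `[0, 1] `&` `[x - r, x + r].

Let mB x r : measurable (B x r : set (measurableTypeR R)).
Proof. by apply: measurableI; exact: measurable_itv. Qed.

Let inB x r y : B x r y <-> 0 <= y <= 1 /\ `|y - x| <= r.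
Proof. by rewrite /B /= !in_itv /= ler_distl. Qed.

(** Expansion by 1/s turns radius s r into r, and the truncations match because [g_i] maps its
    domain onto [0, 1]. *)
Let image_gfun_B i x y r : gpart s i x = Some y ->
  gfun s i @` (B x (s * r) `&` gdom s i) = B y r.
Proof.
move=> /(gpart_Some hs)[y01 xE]; apply/seteqP.
split=> [_ [x' [/inB[_ xr] dx'] <-]|y' /inB[y'01 yr]].
  have : gpart s i x' = Some (gfun s i x') by rewrite /gpart asboolT.
  move=> /(gpart_Some hs); move: (gfun s i x') => g [g01 x'E].
  apply/inB; split=> //; move: xr.
  rewrite x'E xE [X in `|X|](_ : _ = s * (g - y)); last by ring.
  by rewrite normrM (gtr0_norm s_gt0) ler_pM2l.
have : gpart s i ((1 - s) * i%:R + s * y') = Some y' by apply/(gpart_Some hs).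
move=> gx'; move: (gx'); rewrite /gpart; case: asboolP => // dx' [gE].
exists ((1 - s) * i%:R + s * y') => //; split=> //; apply/inB; split.
  case/andP: hs; move: dx'; rewrite /gdom.
  by case: (i) => /=; rewrite in_itv /=; lra.
rewrite xE [X in `|X|](_ : _ = s * (y' - y)); last by ring.
by rewrite normrM (gtr0_norm s_gt0) ler_pM2l.
Qed.

(* A ball of radius s^q around x is expanded to [0, 1] by each of the words
   counted by [num_successors s x q]. *)
Lemma bernoulli_convolution_ball_ge (x : R) (q : nat) : 0 <= x <= 1 ->
  ((2 ^- q * (num_successors s x q)%:R)%:E <=
     nu (`[0%R, 1%R] `&` `[(x - s ^+ q)%R, (x + s ^+ q)%R]))%E.
Proof.
rewrite -/(B x (s ^+ q)).
elim: q x => [|q IH] x x01.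
  (* A ball of radius 1 around a point of [0, 1] covers [0, 1], which has mass 1. *)
  rewrite num_successors0 expr0 invr1 mulr1.
  rewrite (_ : B x 1 = `[0, 1]%classic); first by rewrite (proj1 hnu).
  apply/seteqP; split=> y; first by case.
  move=> /=; rewrite in_itv /= => y01; apply/inB; split=> //.
  by rewrite ler_norml; case/andP: x01; case/andP: y01; lra.
rewrite (proj2 hnu) //; last exact: subIsetl.
rewrite num_successorsS big_bool natrD [in X in _ * X]addrC.
rewrite !exprS invfM -mulrA !mulrDr EFinD.
(* If [g_i] is undefined at [x], the left side is 0; otherwise the induction hypothesis applies at
   the image of [x]. *)
have half i : ((2^-1 * (2 ^- q *
      (oapp (fun y => num_successors s y q) 0%N (gpart s i x))%:R))%:E <=
    2^-1%:E * nu (gfun s i @` (B x (s * s ^+ q) `&` gdom s i)))%E.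
  rewrite EFinM; apply: lee_wpmul2l; first by rewrite lee_fin.
  case e : (gpart s i x) => [y|] /=; last by rewrite mulr0.
  rewrite (image_gfun_B _ e); apply: IH.
  by have [] := iffLR (gpart_Some hs _ _ _) e.
by apply: leeD; [exact: (half false)|exact: (half true)].
Qed.

Lemma density_integral_le (f : R -> R) (A : set (measurableTypeR R)) (M l : R) :
  is_density nu f -> measurable A -> A `<=` `[0, 1]%classic -> 0 <= M ->
  (forall x, A x -> f x <= M) -> (lebesgue_measure A <= l%:E)%E ->
  (nu A <= (M * l)%:E)%E.
Proof.
move=> [fi fE] mA A01 M0 fM Al; rewrite fE //.
apply: (@le_trans _ _ (\int[@lebesgue_measure R]_(x in A) cst M%:E x)%E).
  apply: le_integral => //.
  - exact: integrableS fi.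
  - apply/integrableP; split; first exact: measurable_cst.
    rewrite (integral_cst (@lebesgue_measure R) mA `|M%:E|%E).
    rewrite (le_lt_trans (lee_wpmul2l _ Al)) //.
    by rewrite -EFinM ltry.
  - by move=> x; rewrite inE => Ax; rewrite lee_fin; exact: fM.
by rewrite integral_cst // EFinM; apply: lee_wpmul2l.
Qed.

(** Suppose f <= M on the interval, and let [y] near its midpoint be mapped to [z] by a word of
    length p. Comparing both bounds for the mass of the ball of radius s^(p+q) around [y] gives
    2^-(p+q) gamma^(p+q)(y) <= 2 M s^(p+q). As gamma^q(z) <= gamma^(p+q)(y), the growth rate of [z]
    is at most 2s. *)
Lemma density_unbounded (f : R -> R) (z a1 a2 : R) :
  is_density nu f -> 0 <= z <= 1 -> 2 * s < growth_rate s z ->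
  0 <= a1 -> a1 < a2 -> a2 <= 1 -> ~ [bounded f x | x in `]a1, a2[%classic].
Proof.
move=> fd z01 gz a10 a12 a21 [M0 [_ fM0]].
pose M := Num.max M0 0 + 1.
have M_gt0 : 0 < M by rewrite ltr_wpDl // le_max lexx orbT.
have fM x : a1 < x < a2 -> f x <= M.
  move=> xa; apply: le_trans (ler_norm _) _; apply: fM0 => //=.
  by rewrite ltr_pwDr // le_max lexx.
(* One quarter of the length bounds the distance of [y] from the midpoint, another the radius
   s^(p+q), so the ball stays inside the interval. *)
have [p _ hp] : \forall p \near \oo, s ^+ p < (a2 - a1) / 4.
  apply: cvgr_lt (cvg_expr _) _ _; last by rewrite divr_gt0 ?subr_gt0.
  by rewrite gtr0_norm //; case/andP: hs.
have {hp} sp := hp p (leqnn p); rewrite /= in sp.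
have x01 : 0 <= (a1 + a2) / 2 <= 1 by lra.
have [w [y [yz [y01 yx]]]] := gword_dense hs p x01 z01.
move: gz; apply/negP; rewrite -leNgt.
have s2 : 0 < 2 * s by rewrite mulr_gt0.
(* The constant collects the factor 2 from the ball's length 2 s^(p+q) and the part of (2s)^(p+q)
   that does not depend on q. *)
apply: (@growth_rate_le _ _ _ _ (M * 2 * (2 * s) ^+ p)) => // [|q].
  by rewrite !mulr_gt0 // exprn_gt0.
have sq : s ^+ (p + q) <= s ^+ p.
  by rewrite exprD ler_piMr ?exprn_ge0 // exprn_ile1 //; case/andP: hs => _ /ltW.
have nuB : (nu (B y (s ^+ (p + q))) <= (M * (2 * s ^+ (p + q)))%:E)%E.
  apply: (density_integral_le fd (@mB y _)) => //; [exact: subIsetl|exact: ltW| |].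
    move=> t /inB[_ ty]; apply: fM.
    move: ty yx; rewrite !ler_norml => /andP[? ?] /andP[? ?]; lra.
  apply: (@le_trans _ _ (lebesgue_measure
    `[(y - s ^+ (p + q)), (y + s ^+ (p + q))]%classic)).
    by apply: le_measure; rewrite ?inE //; exact: subIsetr.
  rewrite lebesgue_measure_itv /= lte_fin; case: ifP => _.
    by rewrite -EFinB lee_fin; lra.
  by rewrite lee_fin mulr_ge0 // exprn_ge0.
have := le_trans (bernoulli_convolution_ball_ge (p + q) y01) nuB.
rewrite lee_fin mulrC ler_pdivrMr ?exprn_gt0 // => h.
have /(_ q) := num_successors_gword _ yz; rewrite size_tuple -(ler_nat R) => h'.
apply: (le_trans h'); apply: (le_trans h); rewrite !exprMn !exprD.
by rewrite le_eqVlt; apply/orP; left; apply/eqP; ring.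
Qed.

(** Continuity at [p] relative to [0, 1] would bound |f| by |f p| + 1 on a nondegenerate interval
    near [p], against [density_unbounded]. *)
Lemma density_discontinuous (f : R -> R) (z p : R) :
  is_density nu f -> 0 <= z <= 1 -> 2 * s < growth_rate s z ->
  0 <= p <= 1 -> ~ (f x @[x --> within `[0, 1]%classic (nbhs p)] --> f p).
Proof.
move=> fd z01 gz /andP[p0 p1] /cvgrPdist_lt/(_ 1 ltr01); rewrite near_withinE.
move=> /nbhs_ballP[e /= e0 he].
(* Truncation to [0, 1] keeps the interval nondegenerate even when [p] is an endpoint. *)
have : Num.max 0 (p - e) < Num.min 1 (p + e).
  by rewrite gt_max !lt_min ltr01; lra.
move/(density_unbounded fd z01 gz); apply.
- by rewrite le_max lexx.
- by rewrite ge_min lexx.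
exists (`|f p| + 1); split=> [|M fM x]; first exact: num_real.
rewrite /= in_itv /= gt_max lt_min => /andP[/andP[x0 px] /andP[x1 xp]].
have : `|f p - f x| < 1.
  apply: he => /=; first by rewrite /ball /= ltr_norml; lra.
  by rewrite in_itv /=; lra.
have := ler_normB (f p) (f p - f x); rewrite subKr.
by lra.
Qed.

End Densities.

Theorem theorem21 (R : realType) (b c : nat -> bool) (u v : seq bool)
    (m n : nat) (s z : R)
    (hb : b = overline (false :: u)) (hm : m = size (false :: u))
    (hc : c = overline (true :: v)) (hn : n = size (true :: v))
    (ib : itinerary R b) (ic : itinerary R c)
    (hs : 2^-1 < s < 1) (hz : 1 - s <= z <= s)
    (xb : address b s = z) (xc : address c s = z) :
  [/\ infinite_set [set d : nat -> bool | periodic d /\ address d s = z],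
      (forall x : R, 0 < x -> x ^- m + x ^- n = 1 -> x <= growth_rate s z)
    & 2 * s < growth_rate s z ->
      forall nu : probability (measurableTypeR R) R,
        is_bernoulli_convolution s nu ->
        (~ exists2 f : R -> R,
             is_density nu f & [bounded f x | x in `[0, 1]%classic]) /\
        (forall f : R -> R, is_density nu f ->
           (forall a1 a2 : R, 0 <= a1 -> a1 < a2 -> a2 <= 1 ->
              ~ [bounded f x | x in `]a1, a2[]%classic) /\
           (forall p : R, 0 <= p <= 1 ->
              ~ (f x @[x --> within `[0, 1]%classic (nbhs p)] --> f p)))].
Proof.
have z01 : 0 <= z <= 1 by rewrite -xb; exact: address_itv.
have uz : gword s (false :: u) z = Some z.
  by rewrite -xb hb; exact: gword_overline.
have vz : gword s (true :: v) z = Some z.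
  by rewrite -xc hc; exact: gword_overline.
split.
- exact: infinite_periodic_addresses uz vz.
- by move=> x x0; rewrite hm hn; exact: growth_rate_ge_root.
- move=> gz nu hnu.
  have unbounded (f : R -> R) (a1 a2 : R) : is_density nu f ->
      0 <= a1 -> a1 < a2 -> a2 <= 1 -> ~ [bounded f x | x in `]a1, a2[%classic].
    by move=> fd; exact: (density_unbounded hs hnu fd z01 gz).
  split.
    (* A density bounded on [0, 1] would be bounded on the open interval (0, 1). *)
    case=> f fd [M [Mr fM]].
    apply: (unbounded f 0 1 fd); rewrite ?lexx ?ltr01 //.
    exists M; split=> // x Mx t t01; apply: fM Mx _ _.
    exact: subset_itv_oo_cc t01.
  move=> f fd; split=> [a1 a2|p]; first exact: unbounded.
  exact: (density_discontinuous hs hnu fd z01 gz).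
Qed.
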